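(* Let $H$ and $H'$ be two three-card hands (three-element subsets of the 81-card SET deck). Then $H$ and $H'$ are isomorphic if and only if they have the same symbol.
   Context: **Deck.** Let $A=\{\text{color},\text{shape},\text{fill},\text{number}\}$ be the set of four attributes. For each $a\in A$ let $V_a$ be the set of three values of attribute $a$: $V_{\text{color}}=\{\text{red, green, purple}\}$, $V_{\text{shape}}=\{\text{oval, diamond, squiggle}\}$, $V_{\text{fill}}=\{\text{solid, empty, stripe}\}$, $V_{\text{number}}=\{\text{single, double, triple}\}$. The SET deck consists of $3^4=81$ cards, exactly one for each choice of a value in each attribute (that is, the deck is identified with $\prod_{a\in A}V_a$). For a card $x$ and $a\in A$, $v_a(x)\in V_a$ denotes the value of $x$ for attribute $a$. A hand is a subset of the deck. **Isomorphism.** Two hands $H$ and $H'$ are isomorphic if there exist a bijection $\varphi:H\to H'$, a permutation $\psi:A\to A$, and for each $a\in A$ a bijection $\vartheta_a:V_a\to V_{\psi(a)}$, such that $v_{\psi(a)}(\varphi(x))=\vartheta_a(v_a(x))$ for every $a\in A$ and every $x\in H$. **Symbol.** Let $H=\{x_1,x_2,x_3\}$ be a hand with exactly three cards. Its symbol is $(t;p_1,p_2,p_3)$, where the $p_i$'s are unordered (i.e. $\{p_1,p_2,p_3\}$ is regarded as a multiset). Here $t$ is the number of attributes $a\in A$ on which all three cards have the same value, and the $p_i$'s are, for each of the three pairs of cards of $H$, the number of attributes on which the two cards of that pair have the same value but which are not among the $t$ attributes common to all three cards. Two symbols are the same if their $t$'s are equal and their multisets of $p_i$'s are equal. *)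

(* Defs.v *)
From HB Require Import structures.
From mathcomp Require Import all_boot perm finmap multiset.
Set Implicit Arguments.
Unset Strict Implicit.
Unset Printing Implicit Defensive.
Local Open Scope mset_scope.
Local Open Scope nat_scope.

Variant attribute := Color | Shape | Fill | Number.
Variant color_value := Red | Green | Purple.
Variant shape_value := Oval | Diamond | Squiggle.
Variant fill_value := Solid | Empty | Stripe.
Variant number_value := Single | Double | Triple.

Definition ord_of_attribute (x : attribute) : 'I_4 :=
  match x with
  | Color => @Ordinal 4 0 isT
  | Shape => @Ordinal 4 1 isT
  | Fill => @Ordinal 4 2 isT
  | Number => @Ordinal 4 3 isT
  end.
Definition attribute_of_ord (i : 'I_4) : attribute :=
  nth Color [:: Color; Shape; Fill; Number] i.
Lemma ord_of_attributeK : cancel ord_of_attribute attribute_of_ord.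
Proof. by case. Qed.
HB.instance Definition _ :=
  Countable.copy attribute (can_type ord_of_attributeK).
HB.instance Definition _ : isFinite attribute := CanIsFinite ord_of_attributeK.

Definition ord_of_color_value (x : color_value) : 'I_3 :=
  match x with
  | Red => @Ordinal 3 0 isT
  | Green => @Ordinal 3 1 isT
  | Purple => @Ordinal 3 2 isT
  end.
Definition color_value_of_ord (i : 'I_3) : color_value :=
  nth Red [:: Red; Green; Purple] i.
Lemma ord_of_color_valueK : cancel ord_of_color_value color_value_of_ord.
Proof. by case. Qed.
HB.instance Definition _ :=
  Countable.copy color_value (can_type ord_of_color_valueK).
HB.instance Definition _ : isFinite color_value := CanIsFinite ord_of_color_valueK.

Definition ord_of_shape_value (x : shape_value) : 'I_3 :=
  match x with
  | Oval => @Ordinal 3 0 isT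
  | Diamond => @Ordinal 3 1 isT
  | Squiggle => @Ordinal 3 2 isT
  end.
Definition shape_value_of_ord (i : 'I_3) : shape_value :=
  nth Oval [:: Oval; Diamond; Squiggle] i.
Lemma ord_of_shape_valueK : cancel ord_of_shape_value shape_value_of_ord.
Proof. by case. Qed.
HB.instance Definition _ :=
  Countable.copy shape_value (can_type ord_of_shape_valueK).
HB.instance Definition _ : isFinite shape_value := CanIsFinite ord_of_shape_valueK.

Definition ord_of_fill_value (x : fill_value) : 'I_3 :=
  match x with
  | Solid => @Ordinal 3 0 isT
  | Empty => @Ordinal 3 1 isT
  | Stripe => @Ordinal 3 2 isT
  end.
Definition fill_value_of_ord (i : 'I_3) : fill_value :=
  nth Solid [:: Solid; Empty; Stripe] i.
Lemma ord_of_fill_valueK : cancel ord_of_fill_value fill_value_of_ord.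
Proof. by case. Qed.
HB.instance Definition _ :=
  Countable.copy fill_value (can_type ord_of_fill_valueK).
HB.instance Definition _ : isFinite fill_value := CanIsFinite ord_of_fill_valueK.

Definition ord_of_number_value (x : number_value) : 'I_3 :=
  match x with
  | Single => @Ordinal 3 0 isT
  | Double => @Ordinal 3 1 isT
  | Triple => @Ordinal 3 2 isT
  end.
Definition number_value_of_ord (i : 'I_3) : number_value :=
  nth Single [:: Single; Double; Triple] i.
Lemma ord_of_number_valueK : cancel ord_of_number_value number_value_of_ord.
Proof. by case. Qed.
HB.instance Definition _ :=
  Countable.copy number_value (can_type ord_of_number_valueK).
HB.instance Definition _ : isFinite number_value := CanIsFinite ord_of_number_valueK.

Definition value (a : attribute) : finType :=
  match a with
  | Color => color_value
  | Shape => shape_value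
  | Fill => fill_value
  | Number => number_value
  end.

(* For x : deck, the value of x for attribute a is the application x a. *)
Definition deck := {dffun forall a : attribute, value a}.

Definition hand := {set deck}.

Definition isomorphic (H H' : hand) : Prop :=
  exists (phi : {x : deck | x \in H} -> {x : deck | x \in H'})
         (psi : {perm attribute})
         (theta : forall a : attribute, value a -> value (psi a)),
    [/\ bijective phi,
        forall a, bijective (theta a)
      & forall (a : attribute) (x : {x : deck | x \in H}),
          val (phi x) (psi a) = theta a (val x a)].

Definition common (S : {set deck}) : {set attribute} :=
  [set a | [forall x in S, forall y in S, x a == y a]].

Definition pairs (H : hand) : {set {set deck}} :=
  [set P : {set deck} | (P \subset H) && (#|P| == 2)].

Definition symbol (H : hand) : nat * {mset nat} :=
  (#|common H|,
   seq_mset [seq #|common P :\: common H| | P <- enum (pairs H)]).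

(* Main.v *)
(** Record, for each attribute, which of the three pairs of cards agree on it.
    Only five of the eight patterns occur, and the symbol counts the attributes
    of each pattern other than "all different"; since there are four attributes
    in total it counts those too. Hence the symbol, together with a matching of
    the [p_i]'s, says exactly that the attributes can be permuted so as to
    preserve the patterns. Two triples of values with the same pattern are
    finally matched by a bijection between the value sets. *)
Require Import Defs.
From mathcomp Require Import all_boot perm finmap multiset.

Set Implicit Arguments.
Unset Strict Implicit.
Unset Printing Implicit Defensive.

(** * Bijections that respect a labelling *)

Lemma sum_card_fiber (T L : finType) (f : T -> L) :
  \sum_l #|[set t | f t == l]| = #|T|.
Proof.
rewrite -sum1_card (partition_big f xpredT) //=.
by apply: eq_bigr => l _; rewrite -sum1_card; apply: eq_bigl => t; rewrite inE.
Qed.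

Lemma card_fiber (T : finType) (L : eqType) (f : T -> L) l :
  #|[set t | f t == l]| = count_mem l [seq f t | t <- enum T].
Proof.
by rewrite cardsE cardE {1}/enum_mem size_filter count_map -enumT; apply: eq_count.
Qed.

(** The [n]-th element of a fiber of [f] goes to the [n]-th element of the fiber of [g] over the
    same label. The default [u0] is never reached, by [ltG]. *)
Lemma fiber_bij (T U : finType) (L : eqType) (f : T -> L) (g : U -> L) (u0 : U) :
    #|T| = #|U| -> (forall l, #|[set t | f t == l]| = #|[set u | g u == l]|) ->
  exists2 h : T -> U, bijective h & forall t, g (h t) = f t.
Proof.
move=> cardTU fiberE.
pose F l := enum [set t | f t == l]; pose G l := enum [set u | g u == l].
have memF t : t \in F (f t) by rewrite mem_enum inE.
have ltG t : index t (F (f t)) < size (G (f t)).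
  by rewrite -cardE -fiberE cardE index_mem memF.
pose h t := nth u0 (G (f t)) (index t (F (f t))).
have gh t : g (h t) = f t.
  by have := mem_nth u0 (ltG t); rewrite mem_enum inE => /eqP.
exists h => //; apply: inj_card_bij; last by rewrite cardTU.
move=> t t' eq_h; have eq_f : f t = f t' by rewrite -!gh eq_h.
have /eqP : h t = h t' by [].
rewrite /h -eq_f nth_uniq ?enum_uniq ?ltG //; last by rewrite eq_f ltG.
move=> /eqP eq_i; rewrite -(nth_index t (memF t)) eq_i nth_index //.
by rewrite eq_f memF.
Qed.

(** The fibers partition each type, so equal totals settle the fiber over [l0]; summing over the
    labels is why [L] is finite here. *)
Lemma fiber_bij_but1 (T U L : finType) (f : T -> L) (g : U -> L) (u0 : U) l0 :
    #|T| = #|U| ->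
    (forall l, l != l0 -> #|[set t | f t == l]| = #|[set u | g u == l]|) ->
  exists2 h : T -> U, bijective h & forall t, g (h t) = f t.
Proof.
move=> cardTU fiberE; apply: fiber_bij => // l.
have [-> | ] := eqVneq l l0; last exact: fiberE.
have := cardTU; rewrite -(sum_card_fiber f) -(sum_card_fiber g).
rewrite (bigD1 l0) // [RHS](bigD1 l0) //= (eq_bigr _ fiberE).
exact: addIn.
Qed.

(* The label of [t] is the canonical [i], if any, with [f i = t]; it depends on
   the kernel of [f] only. *)
Lemma same_kernel_bij (I T U : finType) (f : I -> T) (g : I -> U) (i0 : I) :
    #|T| = #|U| -> (forall i j, (f i == f j) = (g i == g j)) ->
  exists2 h : T -> U, bijective h & forall i, h (f i) = g i.
Proof.
move=> cardTU kerE.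
pose lf t := [pick i | f i == t]; pose lg u := [pick i | g i == u].
have lfE i : lf (f i) = lg (g i) by apply: eq_pick => j /=; rewrite kerE.
(* The label [Some i] is carried by one value if [i] is the canonical index of its own kernel class,
   and by none otherwise. *)
have fiber1 (V : finType) (k : I -> V) i :
    #|[set v | [pick j | k j == v] == Some i]| = ([pick j | k j == k i] == Some i).
  case: eqP => [ki | nki].
    apply/eqP/cards1P; exists (k i); apply/setP => v; rewrite !inE.
    apply/eqP/eqP => [|-> //].
    by case: pickP => // j /eqP <- [->].
  apply/eqP; rewrite cards_eq0; apply/eqP/setP => v; rewrite !inE.
  apply/eqP => kv; apply: nki; rewrite -[RHS]kv; suff -> : k i = v by [].
  by move: kv; case: pickP => // j /eqP <- [->].
(* [None] labels the values outside the image; their number follows from [cardTU]. *)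
have [|h bij_h lh] := @fiber_bij_but1 T U _ lf lg (g i0) None cardTU.
  by case=> // i _; rewrite !fiber1 -/(lf _) -/(lg _) lfE.
exists h => // i; have := lh (f i); rewrite lfE /lg.
case: (pickP (fun k => g k == g i)) => [k /eqP gk | /(_ i)]; last by rewrite eqxx.
by case: pickP => // j /eqP <- [->].
Qed.

(** * Agreement sets and the symbol *)

Lemma card_value a : #|value a| = 3.
Proof.
have card3 (T : finType) (f : T -> 'I_3) g : cancel f g -> cancel g f -> #|T| = 3.
  by move=> fK gK; rewrite (bij_eq_card (Bijective fK gK)) card_ord.
case: a;
  [ apply: (card3 _ _ _ ord_of_color_valueK)
  | apply: (card3 _ _ _ ord_of_shape_valueK)
  | apply: (card3 _ _ _ ord_of_fill_valueK)
  | apply: (card3 _ _ _ ord_of_number_valueK) ];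
  by case=> [[|[|[|]]]] // ?; apply: val_inj.
Qed.

(** Sets of elements of the subtype are used because the card bijection of an isomorphism is defined
    only there. *)
Definition agree (H : hand) (D : {set {x : deck | x \in H}}) : {set attribute} :=
  [set a | [forall u in D, forall v in D, val u a == val v a]].

Lemma agreeP (H : hand) (D : {set {x : deck | x \in H}}) (a : attribute) :
  reflect {in D &, forall u v, (val u : deck) a = (val v : deck) a} (a \in agree D).
Proof.
rewrite inE; apply: (iffP forall_inP) => [eqD u v uD vD | eqD u uD].
  by apply/eqP; move/forall_inP: (eqD u uD); apply.
by apply/forall_inP => v vD; apply/eqP/eqD.
Qed.

Lemma common_imset (H : hand) (D : {set {x : deck | x \in H}}) :
  common (val @: D) = agree D.
Proof.
apply/setP => a; rewrite inE; apply/idP/agreeP => [/forall_inP eqD u v uD vD | eqD].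
  move/forall_inP: (eqD _ (imset_f val uD)) => /(_ _ (imset_f val vD)).
  by move/eqP.
apply/forall_inP => _ /imsetP[u uD ->]; apply/forall_inP => _ /imsetP[v vD ->].
by apply/eqP/eqD.
Qed.

Lemma imset_val_setT (H : hand) : val @: [set: {x : deck | x \in H}] = H.
Proof.
apply/setP => x; apply/imsetP/idP => [[u _ ->] | xH]; first exact: valP.
by exists (Sub x xH).
Qed.

(** In a three-card hand, this is the $p_i$ of the pair that omits [z]. *)
Definition pair_agree (H : hand) (z : {x : deck | x \in H}) : nat :=
  #|agree [set~ z] :\: agree [set: {x : deck | x \in H}]|.

Section ThreeCards.

Variables (H : hand) (cardH : #|H| = 3).
Let T : finType := {x : deck | x \in H}.

Lemma card_hand_sub : #|T| = 3.
Proof. by rewrite card_sig. Qed.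

(* A pair of cards is indexed by the card it leaves out. *)
Lemma pairsE : pairs H = [set val @: [set~ z] | z in [set: T]].
Proof.
apply/setP => P; rewrite inE; apply/andP/imsetP => [[PH /eqP cardP] | [z _ ->]].
  have /cards1P[x Dx] : #|H :\: P| == 1.
    by rewrite cardsD (setIidPr PH) cardH cardP.
  have xH : x \in H by have := set11 x; rewrite -Dx => /setDP[].
  exists (Sub x xH) => //; apply/setP => y; apply/idP/imsetP => [yP | [u]].
    exists (Sub y (subsetP PH y yP)) => //; rewrite !inE -val_eqE /=.
    apply: contraTneq yP => ->.
    by have := set11 x; rewrite -Dx => /setDP[].
  rewrite !inE -val_eqE /= => ux ->; apply: contraNT ux => uP.
  by rewrite -in_set1 -Dx inE uP (valP u).
rewrite card_imset ?cardsC1 ?card_hand_sub //; last exact: val_inj.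
by split=> //; apply/subsetP => _ /imsetP[u _ ->]; apply: valP.
Qed.

(** With the $p_i$'s indexed by cards, equality of the multisets becomes equality of the fiber sizes
    of [pair_agree]. *)
Lemma symbolE :
  symbol H = (#|agree [set: T]|, seq_mset [seq pair_agree z | z <- enum T]).
Proof.
rewrite /symbol -{1}(imset_val_setT H) common_imset; congr (_, _).
apply/eq_seq_msetP.
have inj_compl : injective (fun z : T => val @: [set~ z] : {set deck}).
  move=> z w /(imset_inj val_inj) /setP /(_ z).
  by rewrite !inE eqxx; case: eqP.
have perm_pairs : perm_eq (enum (pairs H)) [seq val @: [set~ z] | z : T].
  apply: uniq_perm; rewrite ?enum_uniq ?(map_inj_uniq inj_compl) ?enum_uniq //.
  move=> P; rewrite mem_enum pairsE.
  apply/imsetP/mapP => [] [z _ ->]; exists z => //; exact: mem_enum.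
apply: perm_trans (perm_map _ perm_pairs) _; rewrite -map_comp.
have pair_agreeE (z : T) : #|common (val @: [set~ z]) :\: common H| = pair_agree z.
  by rewrite /pair_agree -!common_imset imset_val_setT.
by rewrite (eq_map pair_agreeE).
Qed.

(** * Agreement patterns of three cards *)

Lemma hand_subP : exists u v w : T,
  [/\ uniq [:: u; v; w] & forall z : T, z \in [:: u; v; w]].
Proof.
have := card_hand_sub; rewrite cardE.
have := enum_uniq T; have := mem_enum T.
case: (enum T) => [|u [|v [|w []]]] //= all_uvw uniq_uvw _; exists u, v, w.
by split=> // z; rewrite all_uvw.
Qed.

(** The cyclic order makes the entries correspond to the omitted cards [w], [u], [v]. *)
Definition pattern (u v w : T) a :=
  (val u a == val v a, val v a == val w a, val w a == val u a).

Lemma agree_pair (u v : T) a : (a \in agree [set u; v]) = (val u a == val v a).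
Proof.
apply/agreeP/eqP => [eq_uv | eq_uv x y]; first by apply: eq_uv; rewrite !inE eqxx ?orbT.
by rewrite !inE => /orP[] /eqP -> /orP[] /eqP ->.
Qed.

Lemma setC1_pair (u v w : T) :
  uniq [:: u; v; w] -> (forall z : T, z \in [:: u; v; w]) -> [set~ w] = [set u; v].
Proof.
move=> uniq_uvw all_uvw; apply/setP => z; have := all_uvw z; rewrite !inE.
move: uniq_uvw; rewrite /= !inE negb_or => /andP[/andP[_ neq_uw] /andP[neq_vw _]].
case/or3P => /eqP ->; rewrite ?eqxx ?orbT ?neq_uw ?neq_vw //.
by rewrite ![w == _]eq_sym (negPf neq_uw) (negPf neq_vw).
Qed.

Lemma agree_setT (u v w : T) a : (forall z : T, z \in [:: u; v; w]) ->
  (a \in agree [set: T]) = (pattern u v w a == (true, true, true)).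
Proof.
move=> all_uvw; apply/agreeP/eqP => [eqT | [/eqP uv /eqP vw _] x y _ _].
  have eq_val (x y : T) : (val x a == val y a) = true.
    by apply/eqP; apply: eqT; apply: in_setT.
  by rewrite /pattern !eq_val.
have eq_u (z : T) : val z a = val u a.
  by have := all_uvw z; rewrite !inE => /or3P[] /eqP -> //; rewrite -vw.
by rewrite !eq_u.
Qed.

Lemma card_pattern u v w l :
    uniq [:: u; v; w] -> (forall z : T, z \in [:: u; v; w]) ->
    l != (false, false, false) ->
  #|[set a | pattern u v w a == l]| =
    match l with
    | (true, true, true) => #|agree [set: T]|
    | (true, false, false) => pair_agree w
    | (false, true, false) => pair_agree u
    | (false, false, true) => pair_agree v
    | _ => 0
    end.
Proof.
move=> uniq_uvw all_uvw.
have Cw := setC1_pair uniq_uvw all_uvw.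
have Cu : [set~ u] = [set v; w].
  apply: setC1_pair => [|z]; last by rewrite -[_ :: _]/(rot 1 [:: u; v; w]) mem_rot.
  by rewrite -[_ :: _]/(rot 1 [:: u; v; w]) rot_uniq.
have Cv : [set~ v] = [set w; u].
  apply: setC1_pair => [|z]; last by rewrite -[_ :: _]/(rot 2 [:: u; v; w]) mem_rot.
  by rewrite -[_ :: _]/(rot 2 [:: u; v; w]) rot_uniq.
(* Transitivity of equality excludes exactly two [true] entries. *)
have patternP a : pattern u v w a \in
    [:: (true, true, true); (true, false, false); (false, true, false);
        (false, false, true); (false, false, false)].
  by rewrite /pattern; do 3![case: eqP => ?] => //; congruence.
have inT a := agree_setT a all_uvw.
rewrite /pair_agree Cu Cv Cw.
case: l => [[[] []] []] // _;
  [|apply: eq_card0 => a|apply: eq_card0 => a| |apply: eq_card0 => a| |].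
- by apply: eq_card => a; rewrite inE inT.
- by rewrite inE; have := patternP a; case: eqP => // ->.
- by rewrite inE; have := patternP a; case: eqP => // ->.
- apply: eq_card => a; rewrite inE in_setD inT agree_pair.
  by have := patternP a; rewrite /pattern; do 3![case: eqP => ?].
- by rewrite inE; have := patternP a; case: eqP => // ->.
- apply: eq_card => a; rewrite inE in_setD inT agree_pair.
  by have := patternP a; rewrite /pattern; do 3![case: eqP => ?].
- apply: eq_card => a; rewrite inE in_setD inT agree_pair.
  by have := patternP a; rewrite /pattern; do 3![case: eqP => ?].
Qed.

End ThreeCards.

(** * The two implications *)

(** Since each [theta a] is injective, [psi] carries agreement sets onto agreement sets of the image
    cards, and [phi] matches the omitted cards. *)
Lemma isomorphic_symbol (H H' : hand) : #|H| = 3 -> #|H'| = 3 ->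
  isomorphic H H' -> symbol H = symbol H'.
Proof.
move=> cardH cardH' [phi [psi [theta [bij_phi bij_theta theta_phi]]]].
have agree_phi (D : {set {x : deck | x \in H}}) : agree (phi @: D) = psi @: agree D.
  have agree_psi a : (psi a \in agree (phi @: D)) = (a \in agree D).
    apply/agreeP/agreeP => eqD u v; last first.
      by move=> /imsetP[x xD ->] /imsetP[y yD ->]; rewrite !theta_phi (eqD x y).
    move=> uD vD; apply: (bij_inj (bij_theta a)).
    by rewrite -!theta_phi; apply: eqD; apply: imset_f.
  apply/setP => b; rewrite -(permKV psi b) agree_psi.
  by rewrite (mem_imset _ _ perm_inj).
have imsetT : phi @: [set: {x : deck | x \in H}] = [set: {x : deck | x \in H'}].
  have [phi' phiK phi'K] := bij_phi.
  by apply/setP => y; rewrite inE -(phi'K y) imset_f.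
have imsetC1 z : phi @: [set~ z] = [set~ phi z].
  have [phi' phiK phi'K] := bij_phi.
  apply/setP => y; rewrite -(phi'K y) (mem_imset _ _ (bij_inj bij_phi)) !inE.
  by rewrite (inj_eq (bij_inj bij_phi)).
have pair_phi z : pair_agree (phi z) = pair_agree z.
  rewrite /pair_agree -imsetC1 -imsetT !agree_phi !cardsD -imsetI.
    by rewrite !(card_imset _ perm_inj).
  by move=> ? ? _ _; apply: perm_inj.
rewrite !symbolE //; congr (_, _).
  by rewrite -imsetT agree_phi card_imset //; apply: perm_inj.
apply/eq_seq_msetP; rewrite -(eq_map pair_phi) map_comp.
apply: perm_map; apply: uniq_perm => [||y].
- by rewrite map_inj_uniq ?enum_uniq //; apply: bij_inj.
- exact: enum_uniq.
have [phi' phiK phi'K] := bij_phi.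
by rewrite -(phi'K y) (mem_map (bij_inj bij_phi)) !mem_enum.
Qed.

Lemma symbol_isomorphic (H H' : hand) : #|H| = 3 -> #|H'| = 3 ->
  symbol H = symbol H' -> isomorphic H H'.
Proof.
move=> cardH cardH'; rewrite !symbolE // => -[eq_t /eq_seq_msetP eq_p].
have [u [v [w [uniq_uvw all_uvw]]]] := hand_subP cardH.
have [u' _] := hand_subP cardH'.
(* Equal multisets give a [phi] that preserves the $p_i$ of the pair omitting each card. *)
have [|l|phi bij_phi phi_p] := fiber_bij (f := @pair_agree H) (g := @pair_agree H') u'.
- by rewrite !card_hand_sub.
- by rewrite !card_fiber; move/seq.permP: eq_p; apply.
have uniq_phi : uniq [:: phi u; phi v; phi w].
  by rewrite -[_ :: _]/(map phi [:: u; v; w]) map_inj_uniq //; apply: bij_inj.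
have all_phi z : z \in [:: phi u; phi v; phi w].
  have [phi' phiK phi'K] := bij_phi.
  by rewrite -(phi'K z) -[_ :: _]/(map phi [:: u; v; w]) map_f.
(* [psi] preserves patterns; the all-different pattern, which the symbol does not count, is the
   exceptional label. *)
have [|l l_neq|psi bij_psi psi_pattern] := fiber_bij_but1
    (f := pattern u v w) (g := pattern (phi u) (phi v) (phi w))
    (l0 := (false, false, false)) Color.
- by [].
- by rewrite !card_pattern // !phi_p eq_t.
(* Up to symmetry, two cards are equal or form one of the three pairs recorded by the pattern. *)
have kerE a (x y : {x | x \in H}) :
    (val x a == val y a) = (val (phi x) (psi a) == val (phi y) (psi a)).
  case: (psi_pattern a) => uvE vwE wuE.
  have := all_uvw x; have := all_uvw y; rewrite !inE.
  by do 2 case/or3P => /eqP ->; rewrite ?eqxx ?uvE ?vwE ?wuE //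
    [LHS]eq_sym [RHS]eq_sym ?uvE ?vwE ?wuE.
pose psi_perm := perm (bij_inj bij_psi).
(* For a fixed [a], [kerE] says that the values of the cards at [a] and of their images at [psi a]
   have the same kernel. *)
have /fin_all_exists2[theta bij_theta theta_phi] a :
    exists2 h : value a -> value (psi_perm a),
      bijective h &
        forall x : {x | x \in H}, h (val x a) = val (phi x) (psi_perm a).
  apply: (same_kernel_bij (f := fun x : {x | x \in H} => val x a) u _ _).
    by rewrite !card_value.
  by move=> x y; rewrite kerE permE.
by exists phi, psi_perm, theta; split.
Qed.

Theorem theorem1 (H H' : hand) (cardH : #|H| = 3) (cardH' : #|H'| = 3) :
  isomorphic H H' <-> symbol H = symbol H'.
Proof.
by split; [apply: isomorphic_symbol | apply: symbol_isomorphic].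
Qed.
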